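(* Schreier's space $S$ has the hereditary polynomial Dunford-Pettis property; that is, every closed subspace of $S$ has the polynomial Dunford-Pettis property.
   Context: A finite subset $A=\{n_1<\cdots<n_k\}$ of $\mathbb{N}=\{1,2,\dots\}$ is admissible if $k\le n_1$. Schreier's space $S$ is the completion of the space $c_{00}$ of finitely supported scalar sequences under the norm $\|x\|_S=\sup\{\sum_{j\in A}|x_j| : A\subset\mathbb{N}\text{ admissible}\}$. For a Banach space $E$, ${\mathcal P}({}^kE)$ is the space of scalar-valued continuous $k$-homogeneous polynomials on $E$. A sequence $(x_n)\subset E$ is $\mathcal{P}$-null if $P(x_n)\to 0$ for every $k\in\mathbb{N}$ and every $P\in{\mathcal P}({}^kE)$. A Banach space $E$ has the polynomial Dunford-Pettis property if, for every $\mathcal{P}$-null sequence $(x_n)\subset E$ and every weakly null sequence $(\phi_n)\subset E^*$, $\phi_n(x_n)\to0$. It has the hereditary polynomial Dunford-Pettis property if every closed subspace of $E$ has the polynomial Dunford-Pettis property. *)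

(* Defs.v *)
From HB Require Import structures.
From mathcomp Require Import all_boot all_order all_algebra.
From mathcomp Require Import finmap complex.
From mathcomp Require Import all_classical all_reals all_analysis.

Set Implicit Arguments.
Unset Strict Implicit.
Unset Printing Implicit Defensive.

Import Order.TTheory GRing.Theory Num.Theory.
Import numFieldNormedType.Exports.

Local Open Scope classical_set_scope.
Local Open Scope ring_scope.

(* Common interface to the two scalar fields, R and R[i] for R : realType.  In
   MathComp the norm of a normed module over K takes its values in K (in its
   nonnegative elements), so suprema of norms are taken in K as well; on R[i]
   the order is: x <= y iff y - x is a nonnegative real. *)
HB.mixin Record NumField_hasSup K & Num.NumField K := {
  ge0_supremums : forall A : set K, A !=set0 -> (forall x, A x -> 0 <= x) ->
    ubound A !=set0 -> supremums A !=set0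
}.

#[short(type="scalarFieldType")]
HB.structure Definition ScalarField :=
  {K of Num.NumField K & NumField_hasSup K}.

Section real_scalars.
Variable R : realType.

Lemma real_ge0_supremums (A : set R) : A !=set0 -> (forall x, A x -> 0 <= x) ->
  ubound A !=set0 -> supremums A !=set0.
Proof.
move=> A0 _ uA; exists (sup A); split; first exact: ub_le_sup.
by move=> y Ay; exact: ge_sup.
Qed.

#[export, non_forgetful_inheritance]
HB.instance Definition _ := NumField_hasSup.Build R real_ge0_supremums.
End real_scalars.

Section complex_scalars.
Variable R : realType.

Lemma complex_ge0_supremums (A : set R[i]) :
  A !=set0 -> (forall x, A x -> 0 <= x) ->
  ubound A !=set0 -> supremums A !=set0.
Proof.
move=> [a Aa] A_ge0 [b ub].
have ImA x : A x -> complex.Im x = 0.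
  by move=> /A_ge0; rewrite lecE => /andP[/eqP ->].
pose B := [set complex.Re x | x in A].
have B0 : B !=set0 by exists (complex.Re a), a.
have uB : has_ubound B.
  exists (complex.Re b) => _ [x Ax <-].
  by have := ub _ Ax; rewrite lecE => /andP[].
exists (Complex (sup B) 0); split => [x Ax|y uy].
  rewrite lecE /= (ImA x)// eqxx/=; apply: ub_le_sup => //; by exists x.
have := uy _ Aa; rewrite lecE (ImA a)// => /andP[Imy _].
rewrite lecE /= Imy/=; apply: ge_sup => // _ [x Ax <-].
by have := uy _ Ax; rewrite lecE => /andP[].
Qed.

HB.instance Definition _ := NumField_hasSup.Build R[i] complex_ge0_supremums.
End complex_scalars.

Section supremum_ge0.
Variables (K : scalarFieldType) (A : set K).
Hypothesis A_ge0 : forall x, A x -> 0 <= x.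

Lemma supremum_lub : A !=set0 -> ubound A !=set0 -> supremums A (supremum 0 A).
Proof.
move=> A0 uA; rewrite /supremum ifF; last exact/negbTE/set0P.
by have [x Ax] := ge0_supremums _ A0 A_ge0 uA; case: xgetP => // /(_ x).
Qed.

Lemma supremum_ub x : ubound A !=set0 -> A x -> x <= supremum 0 A.
Proof. by move=> uA Ax; case: supremum_lub => // [|+ _]; [exists x|exact]. Qed.

Lemma supremum_le b : A !=set0 -> ubound A b -> supremum 0 A <= b.
Proof. by move=> A0 ub; case: supremum_lub => // [|_]; [exists b|exact]. Qed.

End supremum_ge0.

Definition dual_pred (K : numFieldType) (E : normedModType K) :
  pred (E -> K^o) := fun f => `[< linear f /\ continuous f >].

Section dual_submod.
Variables (K : numFieldType) (E : normedModType K).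

Lemma dual_submod_closed : subsemimod_closed (@dual_pred K E).
Proof.
split; first split.
- apply/asboolP; split; last by move=> x; exact: cst_continuous.
  by move=> a x y; rewrite /= scaler0 addr0.
- move=> f g /asboolP[lf cf] /asboolP[lg cg]; apply/asboolP; split.
    by move=> a x y; rewrite !fctE lf lg scalerDr addrACA.
  by move=> x; apply: cvgD; [exact: cf|exact: cg].
- move=> a f /asboolP[lf cf]; apply/asboolP; split.
    by move=> b x y; rewrite !fctE lf scalerDr !scalerA mulrC.
  by move=> x; apply: cvgZr; exact: cf.
Qed.

HB.instance Definition _ :=
  GRing.isSubmodClosed.Build K (E -> K^o) (@dual_pred K E) dual_submod_closed.

End dual_submod.

Record dual (K : numFieldType) (E : normedModType K) := Dual {
  dual_val :> E -> K^o;
  dual_valP : dual_val \in @dual_pred K E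
}.

(* When the set of values is nonempty and bounded above, supremum 0 is its least
   upper bound in K (supremum_lub). *)
Definition opnorm (K : numFieldType) (E : normedModType K) (f : E -> K) : K :=
  supremum 0 [set `|f x| | x in [set x | `|x| <= 1]].

Section dual_lmod.
Variables (K : numFieldType) (E : normedModType K).

HB.instance Definition _ := [isSub for @dual_val K E].
HB.instance Definition _ := [Choice of dual E by <:].
HB.instance Definition _ := [SubChoice_isSubLmodule of dual E by <:].

End dual_lmod.

Section dual_norm.
Variables (K : scalarFieldType) (E : normedModType K).
Implicit Types f g : dual E.

Lemma dual_linear f : linear f.
Proof. by have /asboolP[] := dual_valP f. Qed.

Lemma dual_continuous f : continuous f.
Proof. by have /asboolP[] := dual_valP f. Qed.

HB.instance Definition _ f :=
  GRing.isLinear.Build K E K^o *:%R (dual_val f) (dual_linear f).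

Let S f := [set `|f x| | x in [set x : E | `|x| <= 1]].

Let S_ge0 f y : S f y -> 0 <= y. Proof. by case=> x _ <-. Qed.

Let S_neq0 f : S f !=set0.
Proof. by exists `|f 0|, 0 => //=; rewrite normr0. Qed.

Let S_ub f : ubound (S f) !=set0.
Proof.
have /linear_bounded_continuous/bounded_funP/(_ 1)[M fM] :=
  @dual_continuous f.
by exists M => _ [x x1 <-]; exact: fM.
Qed.

Let opnorm_ge0 f : 0 <= opnorm f.
Proof.
apply: le_trans (normr_ge0 (f 0)) _; apply: (supremum_ub (@S_ge0 f) (S_ub f)).
by exists 0 => //=; rewrite normr0.
Qed.

Lemma le_opnorm f x : `|f x| <= opnorm f * `|x|.
Proof.
have [->|x0] := eqVneq x 0; first by rewrite linear0 !normr0 mulr0.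
have nx : 0 < `|x| by rewrite normr_gt0.
rewrite -ler_pdivrMr//.
have -> : `|f x| / `|x| = `|f (`|x|^-1 *: x)|.
  by rewrite linearZ normrZ normfV normr_id mulrC.
apply: (supremum_ub (@S_ge0 f) (S_ub f)); exists (`|x|^-1 *: x) => //=.
by rewrite normrZ normfV normr_id mulVf ?normr_eq0.
Qed.

Let opnormD f g : opnorm (f + g) <= opnorm f + opnorm g.
Proof.
apply: (supremum_le (@S_ge0 _) (S_neq0 (f + g))) => _ [x x1 <-].
rewrite (le_trans (ler_normD _ _))// lerD// (le_trans (le_opnorm _ _))//;
  by rewrite ler_piMr.
Qed.

Let opnormZle (a : K) f : opnorm (a *: f) <= `|a| * opnorm f.
Proof.
apply: (supremum_le (@S_ge0 _) (S_neq0 (a *: f))) => _ [x x1 <-].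
rewrite [X in `|X|](_ : _ = a *: f x)// normrZ ler_wpM2l//.
by rewrite (le_trans (le_opnorm _ _))// ler_piMr.
Qed.

Let opnormZ (a : K) f : opnorm (a *: f) = `|a| * opnorm f.
Proof.
apply/eqP; rewrite eq_le opnormZle andTb.
have [->|a0] := eqVneq a 0; first by rewrite normr0 mul0r opnorm_ge0.
have na : 0 < `|a| by rewrite normr_gt0.
rewrite -ler_pdivlMl// -normfV.
by have := opnormZle a^-1 (a *: f); rewrite scalerK.
Qed.

Let opnorm0_eq0 f : opnorm f = 0 -> f = 0.
Proof.
move=> f0; apply/val_inj/funext => x; apply/eqP.
by rewrite -normr_le0 (le_trans (le_opnorm f x))// f0 mul0r.
Qed.

HB.instance Definition _ :=
  Lmodule_isNormed.Build K (dual E) opnormD opnormZ opnorm0_eq0.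

End dual_norm.

Record closedSubspace (K : numFieldType) (E : normedModType K) :=
  ClosedSubspace {
    subspace_set : set E;
    subspace_submod : GRing.submod_closed (fun x => `[< subspace_set x >]);
    subspace_closed : closed subspace_set
  }.

Definition subspace_pred (K : numFieldType) (E : normedModType K)
  (M : closedSubspace E) : pred E := fun x => `[< subspace_set M x >].

HB.instance Definition _ (K : numFieldType) (E : normedModType K)
    (M : closedSubspace E) :=
  GRing.isSubmodClosed.Build K E (subspace_pred M) (subspace_submod M).

Record subspaceType (K : numFieldType) (E : normedModType K)
    (M : closedSubspace E) := SubspaceType {
  subspace_val :> E;
  subspace_valP : subspace_val \in subspace_pred M
}.

Section subspace_normed.
Variables (K : numFieldType) (E : normedModType K) (M : closedSubspace E).

HB.instance Definition _ := [isSub for @subspace_val K E M].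
HB.instance Definition _ := [Choice of subspaceType M by <:].
HB.instance Definition _ := [SubChoice_isSubLmodule of subspaceType M by <:].

Implicit Types x y : subspaceType M.

Let snorm x : K := `|val x|.

Let snormD x y : snorm (x + y) <= snorm x + snorm y.
Proof. by rewrite /snorm raddfD ler_normD. Qed.

Let snormZ (a : K) x : snorm (a *: x) = `|a| * snorm x.
Proof. by rewrite /snorm linearZ normrZ. Qed.

Let snorm0_eq0 x : snorm x = 0 -> x = 0.
Proof. by move=> /normr0_eq0 x0; apply: val_inj; rewrite raddf0. Qed.

HB.instance Definition _ :=
  Lmodule_isNormed.Build K (subspaceType M) snormD snormZ snorm0_eq0.

Lemma subspace_normE x : `|x| = `|val x|. Proof. by []. Qed.

End subspace_normed.

Section subspace_complete.
Variables (K : numFieldType) (E : completeNormedModType K).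
Variable M : closedSubspace E.

Lemma subspace_complete (F : set_system (subspaceType M)) :
  ProperFilter F -> cauchy F -> cvg F.
Proof.
move=> FF /cauchy_ballP Fc.
have /cauchy_cvg/cvg_ex[l Fl] : cauchy (val @ F).
  apply/cauchy_ballP => e e0; have [[A B] /= [FA FB] AB] := Fc e e0.
  exists (val @` A, val @` B) => /=.
    by split; [apply: filterS FA|apply: filterS FB] => x Ax; exists x.
  move=> [_ _] /= [[x Ax <-] [y By <-]].
  by have := AB (x, y) (conj Ax By); rewrite -!ball_normE.
have Ml : subspace_set M l.
  apply: (@closed_cvg _ _ F _ val _ (@subspace_closed _ _ M) _ _ Fl).
  by apply: nearW => x; have /asboolP := subspace_valP x.
have Ml' : l \in subspace_pred M by apply/asboolP.
apply/cvg_ex; exists (SubspaceType Ml').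
apply/cvgrPdist_lt => e e0; move/cvgrPdist_lt: Fl => /(_ e e0).
by apply: filterS => x; rewrite subspace_normE raddfB.
Qed.

HB.instance Definition _ :=
  Uniform_isComplete.Build (subspaceType M) subspace_complete.

End subspace_complete.

(* dfwith v i x is v with its i-th entry replaced by x. *)
Definition multilinear (K : numFieldType) (E : normedModType K) (k : nat)
    (L : ('I_k -> E) -> K) :=
  forall (v : 'I_k -> E) (i : 'I_k) (a : K) (x y : E),
    L (dfwith v i (a *: x + y)) = a * L (dfwith v i x) + L (dfwith v i y).

Definition homogeneous_polynomial (K : numFieldType) (E : normedModType K)
    (k : nat) (P : E -> K^o) :=
  exists2 L : ('I_k -> E) -> K, multilinear L & forall x, P x = L (fun=> x).

Definition P_null (K : numFieldType) (E : normedModType K) (x : nat -> E) :=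
  forall (k : nat) (P : E -> K^o), (0 < k)%N ->
    homogeneous_polynomial k P -> continuous P ->
    P (x n) @[n --> \oo] --> (0 : K^o).

Definition weakly_null (K : scalarFieldType) (E : normedModType K)
    (x : nat -> E) :=
  forall phi : dual E, phi (x n) @[n --> \oo] --> (0 : K^o).

Definition polynomial_Dunford_Pettis (K : scalarFieldType)
    (E : completeNormedModType K) :=
  forall (x : nat -> E) (phi : nat -> dual E),
    P_null x -> weakly_null phi -> phi n (x n) @[n --> \oo] --> (0 : K^o).

Definition hereditary_polynomial_Dunford_Pettis (K : scalarFieldType)
    (E : completeNormedModType K) :=
  forall M : closedSubspace E, polynomial_Dunford_Pettis (subspaceType M).

(* Sequences are indexed from 0: the index j : nat stands for the positive
   integer j.+1.  As n_1 is the least element of A, the condition k <= n_1 says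
   that k is at most every element of A. *)
Definition admissible (A : {fset nat}) :=
  forall j, j \in A -> (#|` A| <= j.+1)%N.

Definition c00_pred (K : numFieldType) : pred (nat -> K^o) :=
  fun x => `[< finite_set [set j | x j != 0] >].

Section c00_submod.
Variable K : numFieldType.

Lemma c00_submod_closed : subsemimod_closed (@c00_pred K).
Proof.
split; first split.
- apply/asboolP; apply: sub_finite_set (@finite_set0 nat).
  by move=> j /=; rewrite eqxx.
- move=> x y /asboolP fx /asboolP fy; apply/asboolP.
  have fxy : finite_set ([set j | x j != 0] `|` [set j | y j != 0]).
    by rewrite finite_setU.
  apply: sub_finite_set fxy.
    move=> j /=; have -> : (x + y) j = x j + y j by [].
    have [->|] := eqVneq (x j) 0; last by left.
    by rewrite add0r; right.
- move=> a x /asboolP fx; apply/asboolP; apply: sub_finite_set fx.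
  move=> j /=; apply: contra_neq.
  rewrite [(a *: x) j]/(a *: x j) => ->; exact: scaler0.
Qed.

HB.instance Definition _ :=
  GRing.isSubmodClosed.Build K (nat -> K^o) (@c00_pred K) c00_submod_closed.

End c00_submod.

Record c00 (K : numFieldType) := C00 {
  c00_val :> nat -> K^o;
  c00_valP : c00_val \in @c00_pred K
}.

Definition schreier_norm (K : numFieldType) (x : nat -> K) : K :=
  supremum 0 [set \sum_(j <- A) `|x j| | A in [set A | admissible A]].

Section c00_lmod.
Variable K : numFieldType.
HB.instance Definition _ := [isSub for @c00_val K].
HB.instance Definition _ := [Choice of c00 K by <:].
HB.instance Definition _ := [SubChoice_isSubLmodule of c00 K by <:].
End c00_lmod.

Section c00_norm.
Variable K : scalarFieldType.
Implicit Types x y : c00 K.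

Let S x :=
  [set \sum_(j <- A) `|x j| | A in [set A : {fset nat} | admissible A]].

Let S_ge0 x t : S x t -> 0 <= t.
Proof. by case=> A _ <-; exact: sumr_ge0. Qed.

Let S_neq0 x : S x !=set0.
Proof. by exists (\sum_(j <- fset0) `|x j|), fset0 => //= j; rewrite inE. Qed.

Let S_ub x : ubound (S x) !=set0.
Proof.
have /asboolP fx := c00_valP x.
pose B := fset_set [set j | x j != 0].
exists (\sum_(j <- B) `|x j|) => _ [A _ <-].
rewrite (bigID (fun j => x j == 0))/= big1 ?add0r; last first.
  by move=> j /eqP->; rewrite normr0.
rewrite -big_filter.
have sAB : {subset [seq j <- A | x j != 0] <= B}.
  by move=> j; rewrite mem_filter => /andP[xj _]; rewrite in_fset_set// inE.
rewrite [leRHS](bigID (mem [seq j <- A | x j != 0]))/=.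
rewrite -[leLHS]addr0 lerD ?sumr_ge0// -[leRHS]big_filter.
rewrite (perm_big [seq j <- B | j \in [seq j <- A | x j != 0]])//.
apply: uniq_perm; rewrite ?filter_uniq ?fset_uniq// => j.
rewrite [RHS]mem_filter.
by have [/sAB|//] := boolP (j \in _).
Qed.

Lemma schreier_sum_le x A : admissible A ->
  \sum_(j <- A) `|x j| <= schreier_norm x.
Proof. by move=> aA; apply: (supremum_ub (@S_ge0 x) (S_ub x)); exists A. Qed.

Let schreierD x y :
  schreier_norm (x + y) <= schreier_norm x + schreier_norm y.
Proof.
apply: (supremum_le (@S_ge0 _) (S_neq0 (x + y))) => _ [A aA <-].
apply: le_trans (lerD (schreier_sum_le x aA) (schreier_sum_le y aA)).
by rewrite -big_split/=; apply: ler_sum => j _; exact: ler_normD.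
Qed.

Let schreierZle (a : K) x : schreier_norm (a *: x) <= `|a| * schreier_norm x.
Proof.
apply: (supremum_le (@S_ge0 _) (S_neq0 (a *: x))) => _ [A aA <-].
apply: le_trans (ler_wpM2l (normr_ge0 a) (schreier_sum_le x aA)).
by rewrite mulr_sumr; apply: ler_sum => j _; rewrite -normrM.
Qed.

Let schreierZ (a : K) x : schreier_norm (a *: x) = `|a| * schreier_norm x.
Proof.
apply/eqP; rewrite eq_le schreierZle andTb.
have [->|a0] := eqVneq a 0.
  rewrite normr0 mul0r.
  apply: le_trans (schreier_sum_le _ (_ : admissible fset0)).
    by rewrite sumr_ge0.
  by move=> j; rewrite inE.
have na : 0 < `|a| by rewrite normr_gt0.
rewrite -ler_pdivlMl// -normfV.
by have := schreierZle a^-1 (a *: x); rewrite scalerK.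
Qed.

Let schreier0_eq0 x : schreier_norm x = 0 -> x = 0.
Proof.
move=> x0; apply/val_inj/funext => j; apply/eqP.
rewrite -normr_le0 -x0.
have := @schreier_sum_le x [fset j]%fset; rewrite big_seq_fset1; apply.
by move=> i _; rewrite cardfs1.
Qed.

HB.instance Definition _ :=
  Lmodule_isNormed.Build K (c00 K) schreierD schreierZ schreier0_eq0.

End c00_norm.

Definition is_completion (K : numFieldType) (V : normedModType K)
    (W : completeNormedModType K) (i : {linear V -> W}) :=
  (forall v, `|i v| = `|v|) /\ dense (range i).

(* Main.v *)
Require Import Defs.
From HB Require Import structures.
From mathcomp Require Import all_boot all_order all_algebra.
From mathcomp Require Import finmap complex.
From mathcomp Require Import all_classical all_reals all_analysis.
From mathcomp Require Import ring zify.

Import Order.TTheory GRing.Theory Num.Theory.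
Import numFieldNormedType.Exports.

Local Open Scope classical_set_scope.
Local Open Scope ring_scope.

(* Let (x_n) be P-null in a closed subspace M of Schreier's space.

   Among n coordinates of x, the half with the largest indices is admissible, so
   the smallest of the n moduli is at most 2|x|/n; removing it and iterating
   gives sum_j |x(j)|^2 <= 8 |x|^2.  Hence sums of squares of coordinates are
   continuous 2-homogeneous polynomials, and a gliding hump argument shows that
   sup_j |x_n(j)| -> 0.  Being bounded as well, (x_n) has subsequences (x_{u k})
   that are close to blocks and so flat that no admissible set meets two of them
   substantially: the sums sum_k t_k x_{u k}, |t_k| <= 1, are bounded (as for
   the unit vector basis of c_0).  For such u, phi |-> sum_k phi(x_{u k}) belongs to
   the bidual of M.

   If phi_n(x_n) does not tend to 0 for some weakly null (phi_n) in M^*, choose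
   u such that moreover the matrix phi_{u m}(x_{u k}) is almost diagonal; the
   functional above then does not tend to 0 along (phi_{u m}).

   Boundedness is itself a gliding hump argument, applied to norming functionals
   weighted by 2^-i. *)

(* A scalarFieldType has suprema of bounded sets of nonnegative elements, which
   does not yield Cauchy completeness of the whole field. *)
Definition cauchy_complete (K : numFieldType) :=
  forall c : nat -> K^o,
    (forall e : K, 0 < e -> exists N, forall m n, (N <= m)%N -> (N <= n)%N ->
       `|c m - c n| <= e) -> cvgn c.

(** * Archimedean property, geometric sums and absolutely convergent series *)

Section Scalars.
Variable K : scalarFieldType.

(** Otherwise the natural numbers would have a supremum [s], and [n + 1 <= s] for every [n] would
    make [s - 1] an upper bound as well. *)
Lemma scalar_archimedean (x : K) : 0 <= x -> exists n : nat, x < n%:R.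
Proof.
move=> x0; apply/not_existsP => H.
have xge n : n%:R <= x.
  rewrite real_leNgt ?realn ?ger0_real//; exact/negP/H.
pose A : set K := range (fun n : nat => n%:R).
have A0 y : A y -> 0 <= y by case=> n _ <-.
have An : A !=set0 by exists 0%:R, 0%N.
have uA : ubound A !=set0 by exists x => _ [n _ <-].
have ub (n : nat) : n%:R <= supremum 0 A by apply: supremum_ub => //; exists n.
have : supremum 0 A <= supremum 0 A - 1.
  apply: supremum_le => // _ [n _ <-].
  by rewrite lerBrDr natr1.
by rewrite lerBrDr gerDl ler10.
Qed.

Lemma near_expr2V_le (e : K) : 0 < e -> \forall n \near \oo, (2 ^+ n)^-1 <= e.
Proof.
move=> e0; have [N eN] : exists N : nat, e^-1 < N%:R.
  by apply: scalar_archimedean; rewrite invr_ge0 ltW.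
exists N => // n /= Nn.
rewrite -[leRHS]invrK lef_pV2 ?posrE ?invr_gt0 ?exprn_gt0//.
apply: le_trans (ltW eN) _; rewrite -natrX ler_nat (leq_trans Nn)//.
exact/ltnW/ltn_expl.
Qed.

Lemma sum_expr2V_le2 N : \sum_(i < N) (2 ^+ i)^-1 <= 2 :> K.
Proof.
suff -> : \sum_(i < N) (2 ^+ i)^-1 = 2 - 2 * (2 ^+ N)^-1 :> K.
  by rewrite gerBl mulr_ge0// invr_ge0 exprn_ge0.
elim: N => [|N IH]; first by rewrite big_ord0 expr0 invr1 mulr1 subrr.
rewrite big_ord_recr/= IH exprS; field.
by rewrite expf_neq0 ?pnatr_eq0//.
Qed.

(** The partial sums of the moduli have a supremum in [K]. Once they are within [e] of it, their
    later increments, which dominate those of the sums of [c], are at most [e]. *)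
Lemma bounded_sum_cvg (Kc : cauchy_complete K) (c : nat -> K) (C : K) :
  (forall N, \sum_(i < N) `|c i| <= C) ->
  cvgn (fun N => \sum_(i < N) c i : K^o).
Proof.
move=> cC; apply: Kc => e e0.
pose s N := \sum_(i < N) `|c i|.
pose A : set K := range s.
have s0 N : 0 <= s N by apply: sumr_ge0.
have A0 y : A y -> 0 <= y by case=> N _ <-.
have An : A !=set0 by exists (s 0%N), 0%N.
have uA : ubound A !=set0 by exists C => _ [n _ <-]; exact: cC.
have ub N : s N <= supremum 0 A by apply: (supremum_ub A0 uA); exists N.
have [N sN] : exists N, supremum 0 A - e <= s N.
  apply/not_existsP => H.
  have : supremum 0 A <= supremum 0 A - e.
    apply: supremum_le => // _ [n _ <-].
    have M0 : 0 <= supremum 0 A by apply: le_trans (ub 0%N); exact: s0.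
    have := H n; move/negP; rewrite -real_ltNge ?realB ?ger0_real//;
      last exact: ltW.
    exact: ltW.
  by rewrite lerBrDr gerDl lt_geF.
have main m n : (N <= m)%N -> (m <= n)%N ->
    `|(\sum_(i < m) c i : K) - (\sum_(i < n) c i : K)| <= e.
  move=> Nm mn; rewrite distrC.
  have dec (f : nat -> K) :
      \sum_(i < n) f i = \sum_(i < m) f i + \sum_(m <= i < n) f i.
    by rewrite -!(big_mkord predT) (big_cat_nat _ mn).
  rewrite dec addrC addKr (le_trans (ler_norm_sum _ _ _))//.
  have := ub n; rewrite /s (dec (fun i => `|c i|)) -/(s m) => h.
  have sNm : s N <= s m.
    rewrite /s -!(big_mkord predT (fun i => `|c i|)) (big_cat_nat _ Nm)//=.
    rewrite lerDl.
    by apply: sumr_ge0 => i _; exact: normr_ge0.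
  rewrite -(lerD2l (s m)) (le_trans h)// -lerBlDr (le_trans sN)//.
exists N => m n Nm Nn; case: (leqP m n) => [|/ltnW] mn; first exact: main.
by rewrite distrC; exact: main.
Qed.

Lemma exists_phase (z : K) : exists2 t : K, `|t| <= 1 & t * z = `|z|.
Proof.
have [->|z0] := eqVneq z 0; first by exists 0; rewrite ?normr0 ?mul0r.
exists (`|z| / z); last by rewrite mulfVK.
by rewrite normf_div normr_id divff// normr_eq0.
Qed.

End Scalars.

(** * Cauchy completeness of the real and complex fields *)

Lemma real_cauchy_complete (R : realType) : cauchy_complete R.
Proof.
move=> c H; apply: cauchy_cvg; apply: cauchy_exP => e e0.
have e20 : 0 < e / 2 by rewrite divr_gt0.
have [N HN] := H _ e20; exists (c N), N => // n /= Nn.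
rewrite -ball_normE/= (le_lt_trans (HN _ _ (leqnn N) Nn))//.
by rewrite ltr_pdivrMr// ltr_pMr// ltr1n.
Qed.

Lemma complex_cauchy_complete (R : realType) : cauchy_complete R[i].
Proof.
move=> c H.
have norm_re (z : R[i]) : `|complex.Re z|%:C%C <= `|z|.
  by rewrite normc_def lecR -sqrtr_sqr ler_wsqrtr// lerDl sqr_ge0.
have norm_im (z : R[i]) : `|complex.Im z|%:C%C <= `|z|.
  by rewrite normc_def lecR -sqrtr_sqr ler_wsqrtr// lerDr sqr_ge0.
have cau (f : R[i] -> R) : (forall x y, f (x - y) = f x - f y) ->
    (forall z, `|f z|%:C%C <= `|z|) -> cvgn (f \o c).
  move=> fB fn; apply: real_cauchy_complete => e e0.
  have [|N HN] := H e%:C%C; first by rewrite ltcR.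
  exists N => m n Nm Nn; rewrite -lecR (le_trans _ (HN m n Nm Nn))//= -fB.
  exact: fn.
have /cvg_ex[/= a ca] : cvgn ((@complex.Re R) \o c).
  by apply: cau => // -[? ?] [? ?].
have /cvg_ex[/= b cb] : cvgn ((@complex.Im R) \o c).
  by apply: cau => // -[? ?] [? ?].
apply/cvg_ex; exists (Complex a b).
apply/cvgrPdist_le => e e0.
(* A positive element of [R[i]] has zero imaginary part, so the tolerance is real. *)
move: (e0); case: e {e0} => e e' /=; rewrite ltcE/=.
move=> /andP[/eqP e'0 e0]; subst e'.
have e20 : 0 < e / 2 by rewrite divr_gt0.
move/cvgrPdist_le : ca => /(_ _ e20) ca.
move/cvgrPdist_le : cb => /(_ _ e20) cb.
near=> n.
have -> : Complex a b - c n =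
    (a - complex.Re (c n))%:C%C + 'i%C * (b - complex.Im (c n))%:C%C.
  case: (c n) => x y; simpc; congr Complex; ring.
apply: le_trans (ler_normD _ _) _.
have -> : Complex e 0 = (e / 2)%:C%C + (e/2)%:C%C.
  by rewrite -rmorphD/= -splitr.
apply: lerD; last rewrite normrM.
  rewrite normc_def/= expr0n addr0 sqrtr_sqr lecR; near: n; exact: ca.
have -> : `|'i%C : R[i]| = 1 by rewrite normc_def/= expr0n add0r expr1n sqrtr1.
rewrite mul1r normc_def/= expr0n addr0 sqrtr_sqr lecR; near: n; exact: cb.
Unshelve. all: by end_near. Qed.

(** * Recursive choice of subsequences *)

Lemma near_all_mem (T : eqType) (s : seq T) (P : T -> nat -> Prop) :
  (forall x, \forall n \near \oo, P x n) ->
  \forall n \near \oo, forall x, x \in s -> P x n.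
Proof.
move=> H; elim: s => [|a s IH]; first exact: nearW.
near=> n => x; rewrite inE => /orP[/eqP ->|]; first by near: n; exact: H.
by move: x; near: n; exact: IH.
Unshelve. all: by end_near. Qed.

(** The list [s] holds the indices chosen so far. Since [Q s] holds eventually, the next index can
    satisfy it and exceed all members of [s]. *)
Lemma exists_subsequence (Q : seq nat -> nat -> Prop) :
  (forall s, \forall n \near \oo, Q s n) ->
  exists u : nat -> nat,
    {homo u : m n / (m < n)%N} /\ forall k, Q (mkseq u k) (u k).
Proof.
move=> HQ.
have /choice[f Hf] (s : seq nat) :
    exists n, Q s n /\ forall i, i \in s -> (i < n)%N.
  have : \forall n \near \oo, Q s n /\ forall i, i \in s -> (i < n)%N.
    near=> n; split; near: n; first exact: HQ.
    by apply: near_all_mem => i; exists i.+1.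
  by case=> N _ HN; exists N; apply: HN => /=.
pose h k := iter k (fun s => rcons s (f s)) [::].
pose u k := f (h k).
have uh k : mkseq u k = h k by elim: k => // k IH; rewrite mkseqS IH.
exists u; split => [m n mn|k]; last by rewrite uh; case: (Hf (h k)).
have [_] := Hf (h n); apply; rewrite -uh.
by apply/mapP; exists m; rewrite ?mem_iota.
Unshelve. all: by end_near. Qed.

Lemma homo_ltn_ge_id (u : nat -> nat) :
  {homo u : m n / (m < n)%N} -> forall n, (n <= u n)%N.
Proof.
by move=> hu; elim=> // n IH; rewrite (leq_ltn_trans IH)// hu.
Qed.

(** * Gliding humps and limits of scalars *)

Section Limits.
Variable K : scalarFieldType.

(** Rows and columns of [b] vanish at infinity, so each new index can be chosen with tiny entries
    against all earlier ones; the diagonal then dominates every row. [Q] carries further conditions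
    to be met by the same [u]. *)
Lemma gliding_hump (b : nat -> nat -> K) (e : K)
    (Q : seq nat -> nat -> Prop) :
  0 < e -> (forall n, e <= `|b n n|) ->
  (forall i d, 0 < d -> \forall n \near \oo, `|b n i| <= d) ->
  (forall n d, 0 < d -> \forall i \near \oo, `|b n i| <= d) ->
  (forall s, \forall n \near \oo, Q s n) ->
  exists u : nat -> nat, [/\ {homo u : m n / (m < n)%N},
    forall k, Q (mkseq u k) (u k) &
    forall k N, (k < N)%N -> e / 2 <= `|\sum_(i < N) b (u k) (u i)|].
Proof.
move=> e0 bdiag bl br HQ.
(* These tolerances add up to at most [e / 2], half of the diagonal entry. *)
pose d k := e / 4 * (2 ^+ k)^-1.
have d0 k : 0 < d k by rewrite !mulr_gt0 ?invr_gt0 ?exprn_gt0.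
have [s|u [hu Hu]] := @exists_subsequence (fun s n => Q s n /\
    forall i, i \in s -> `|b n i| <= d (size s) /\ `|b i n| <= d (size s)).
  near=> n; split; first by near: n; exact: HQ.
  near: n; apply: near_all_mem => i.
  by near=> n; split; near: n; [exact: bl|exact: br].
exists u; split => // [k|k N kN]; first by case: (Hu k).
(* The later of the two choices made the entry small: for [i < k] it gives [d k], which is at most
   [d i]; for [k < i] it gives [d i] itself. *)
have offdiag i : i != k -> `|b (u k) (u i)| <= d i.
  rewrite neq_ltn => /orP[ik|ki].
    have [_ /(_ (u i))[|+ _]] := Hu k.
      by apply/mapP; exists i; rewrite ?mem_iota.
    move/le_trans; apply; rewrite size_mkseq /d ler_wpM2l ?divr_ge0 ?(ltW e0)//.
    by rewrite lef_pV2 ?posrE ?exprn_gt0// ler_weXn2l ?ler1n// ltnW.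
  have [_ /(_ (u k))[|_ +]] := Hu i.
    by apply/mapP; exists k; rewrite ?mem_iota.
  by rewrite size_mkseq.
rewrite (bigD1 (Ordinal kN))//=.
set r := \sum_(i < N | _) _.
have rle : `|r| <= e / 2.
  apply: le_trans (ler_norm_sum _ _ _) _.
  apply: (@le_trans _ _ (\sum_(i < N) d i)).
    rewrite [leRHS](bigD1 (Ordinal kN))//= -[leLHS]add0r lerD ?(ltW (d0 _))//.
    by apply: ler_sum => i ik; exact: offdiag.
  rewrite -mulr_sumr; apply: le_trans (ler_wpM2l _ (sum_expr2V_le2 _ N)) _.
    by rewrite divr_ge0 ?ltW.
  by rewrite le_eqVlt; apply/orP; left; apply/eqP; field.
have := lerB_dist (b (u k) (u k)) (- r); rewrite normrN opprK.
apply: le_trans; rewrite [e in e / 2]splitr -[leLHS]addr0.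
have -> : e / 2 + e / 2 = e by rewrite -splitr.
have -> : e / 2 + 0 = e - e / 2 by field.
exact: lerB.
Unshelve. all: by end_near. Qed.

Lemma norm_lim_le (u : nat -> K^o) (l : K^o) (C : K) :
  u n @[n --> \oo] --> l -> (\forall n \near \oo, `|u n| <= C) -> `|l| <= C.
Proof.
move=> ul uC; apply/ler_addgt0Pr => e e0.
move/cvgrPdist_le: ul => /(_ e e0) ul.
suff [n [H1 H2]] : exists n, `|l - u n| <= e /\ `|u n| <= C.
  by rewrite -(subrK (u n) l) (le_trans (ler_normD _ _))// addrC lerD.
have : \forall n \near \oo, `|l - u n| <= e /\ `|u n| <= C.
  by near=> n; split; near: n.
by case=> N _ HN; exists N; apply: HN => /=.
Unshelve. all: by end_near. Qed.

Lemma cvg0_near (u : nat -> K^o) : u n @[n --> \oo] --> (0 : K^o) ->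
  forall e : K, 0 < e -> \forall n \near \oo, `|u n| <= e.
Proof. by move=> /cvgr0Pnorm_le. Qed.

Lemma norm_lim_ge (u : nat -> K^o) (l : K^o) (C : K) : 0 <= C ->
  u n @[n --> \oo] --> l -> (\forall n \near \oo, C <= `|u n|) -> C <= `|l|.
Proof.
move=> C0 ul uC; apply/ler_addgt0Pr => e e0.
move/cvgrPdist_le: ul => /(_ e e0) ul.
suff [n [H1 H2]] : exists n, `|l - u n| <= e /\ C <= `|u n|.
  rewrite (le_trans H2)// -(subrK l (u n)) (le_trans (ler_normD _ _))//.
  by rewrite addrC lerD// distrC.
have : \forall n \near \oo, `|l - u n| <= e /\ C <= `|u n|.
  by near=> n; split; near: n.
by case=> N _ HN; exists N; apply: HN => /=.
Unshelve. all: by end_near. Qed.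

Lemma not_cvg0_subsequence (u : nat -> K^o) :
  ~ (u n @[n --> \oo] --> (0 : K^o)) ->
  exists2 e : K, 0 < e & exists2 v : nat -> nat,
    forall n, (n <= v n)%N & forall n, e <= `|u (v n)|.
Proof.
move=> nu; apply/not_exists2P => H; apply: nu; apply/cvgr0Pnorm_le => e e0.
have [//|nv] := H e; apply: contra_notP nv => ne.
suff /choice[v Hv] n : exists m, (n <= m)%N /\ e <= `|u m|.
  by exists v => n; case: (Hv n).
apply: contra_notP ne => /forallNP nm; exists n => // m /= nm'.
have := nm m; move/not_andP => -[//|/negP].
by rewrite -real_ltNge ?realE ?normr_ge0 ?(ltW e0)// => /ltW.
Qed.

Lemma exists_dual (E : normedModType K) (f : E -> K) (C : K) : 0 <= C ->
  (forall a x y, f (a *: x + y) = a * f x + f y) ->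
  (forall x, `|f x| <= C * `|x|) -> exists F : dual E, forall x, F x = f x.
Proof.
move=> C0 fl fC.
have lf : linear (f : E -> K^o) by move=> a x y; exact: fl.
pose G : {linear E -> K^o} :=
  HB.pack (f : E -> K^o) (GRing.isLinear.Build K E K^o *:%R f lf).
have cf : continuous (f : E -> K^o).
  apply/(@linear_bounded_continuous _ _ _ G)/bounded_funP => r.
  exists (C * r) => x xr /=.
  apply: le_trans (fC x) _.
  by rewrite ler_wpM2l.
have dp : (f : E -> K^o) \in @dual_pred K E by apply/asboolP.
by exists (Dual dp).
Qed.

End Limits.

(** * Functionals on normed spaces and on their duals *)

Section Duals.
Variable K : scalarFieldType.

(** The series converges absolutely at each point, and its uniform bound passes to the limit. It is
    applied to weighted norming functionals, and to evaluations on a dual, where [F] lies in the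
    bidual. *)
Lemma exists_sum_dual (Kc : cauchy_complete K) (E : normedModType K)
    (g : nat -> dual E) (C : K) : 0 <= C ->
  (forall x N, \sum_(i < N) `|g i x| <= C * `|x|) ->
  exists F : dual E, forall x,
    (\sum_(i < N) g i x : K^o) @[N --> \oo] --> (F x : K^o).
Proof.
move=> C0 gC.
have cg x : cvgn (fun N => \sum_(i < N) g i x : K^o).
  exact: (@bounded_sum_cvg _ Kc (fun i => g i x) _ (gC x)).
pose f x : K^o := limn (fun N => \sum_(i < N) g i x : K^o).
have fP x : (\sum_(i < N) g i x : K^o) @[N --> \oo] --> f x by exact: cg.
have [||F HF] := @exists_dual _ E f C C0.
- move=> a x y.
  have fxy : (\sum_(i < N) g i (a *: x + y) : K^o) @[N --> \oo] -->
      (a *: f x + f y : K^o).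
    rewrite [X in X @ _ --> _](_ : _ = fun N => a *: (\sum_(i < N) g i x : K^o) +
        (\sum_(i < N) g i y : K^o)).
      exact: cvgD (cvgZ (cvg_cst _) (fP x)) (fP y).
    apply/funext => N; rewrite scaler_sumr -big_split/=; apply: eq_bigr => i _.
    by rewrite linearP.
  exact: (cvg_unique (@norm_hausdorff _ K^o) (fP _) fxy).
- move=> x; apply: norm_lim_le (fP x) _; apply: nearW => N.
  by rewrite (le_trans (ler_norm_sum _ _ _)).
- by exists F => x; rewrite HF.
Qed.

Lemma exists_dual_eval (E : normedModType K) (x : E) :
  exists F : dual (dual E), forall phi : dual E, F phi = phi x.
Proof.
apply: (@exists_dual _ (dual E) (fun phi => phi x) `|x|) => // phi.
by rewrite mulrC; exact: le_opnorm.
Qed.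

Lemma P_null_weakly_null (E : normedModType K) (x : nat -> E) :
  P_null x -> weakly_null x.
Proof.
move=> Px phi; apply: (Px 1%N) => //; last exact: dual_continuous.
exists (fun v => phi (v ord0)) => // v i a y z.
by rewrite (ord1 i) !dfwithin linearP.
Qed.

Lemma weakly_null_val (E : normedModType K) (M : closedSubspace E)
    (x : nat -> subspaceType M) :
  weakly_null x -> weakly_null (fun n => val (x n)).
Proof.
move=> wx phi.
have [|||psi Hpsi] :=
    @exists_dual _ (subspaceType M) (fun y => phi (val y)) `|phi|.
- by [].
- by move=> a y z; exact: (dual_linear phi a (val y) (val z)).
- by move=> y; exact: le_opnorm.
have := wx psi; apply: cvg_trans; apply: near_eq_cvg.
by apply: nearW => n /=; rewrite Hpsi.
Qed.

End Duals.

(** All that later arguments use of the completion. The two norm fields say that the norm is the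
    Schreier norm of the coordinates; [coord_tail] reflects the density of finitely supported
    sequences. *)
Record schreier_coordinates {K : numFieldType} {E : normedModType K}
    (coord : E -> nat -> K) := {
  coord_linear : forall a x y j,
    coord (a *: x + y) j = a * coord x j + coord y j;
  coord_sum_le : forall x A, admissible A ->
    \sum_(j <- A) `|coord x j| <= `|x|;
  norm_le_coord : forall x C, 0 <= C -> (forall A, admissible A ->
    \sum_(j <- A) `|coord x j| <= C) -> `|x| <= C;
  coord_tail : forall x e, 0 < e -> exists p, forall A, admissible A ->
    (forall j, j \in A -> (p <= j)%N) -> \sum_(j <- A) `|coord x j| <= e
}.
Arguments coord_linear {K E coord}.
Arguments coord_sum_le {K E coord}.
Arguments norm_le_coord {K E coord}.
Arguments coord_tail {K E coord}.

Lemma admissible1 j : admissible [fset j]%fset.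
Proof. by move=> i _; rewrite cardfs1. Qed.

(** * Coordinates on the completion of [c00] *)

Section Completion.
Variables (K : scalarFieldType) (Kc : cauchy_complete K).
Variables (S : completeNormedModType K) (i : {linear c00 K -> S}).
Hypothesis Si : is_completion i.

Lemma completion_approx (x : S) (e : K) : 0 < e ->
  exists v : c00 K, `|x - i v| <= e.
Proof.
move=> e0; have [_ /(_ (ball x e))[]] := Si.
- by exists x; exact: ballxx.
- exact: ball_open.
- move=> y [xy [v _ vy]]; exists v; move: xy.
  rewrite -vy -ball_normE; exact: ltW.
Qed.

(** Coordinates of [x] are limits of those of approximants [v (x, n)] in [c00]. The estimate
    [approx] then transfers each property from [c00] to the completion. *)
Lemma exists_schreier_coordinates :
  exists coord : S -> nat -> K, schreier_coordinates coord.
Proof.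
have iN v : `|i v| = `|v| by case: Si.
have e2 n : 0 < (2 ^+ n)^-1 :> K by rewrite invr_gt0 exprn_gt0.
have /choice[v Hv] (xn : S * nat) :
    exists w : c00 K, `|xn.1 - i w| <= (2 ^+ xn.2)^-1.
  exact: completion_approx.
have iB (x : S) (w w' : c00 K) : `|w - w'| <= `|x - i w| + `|x - i w'|.
  by rewrite -iN raddfB (le_trans (ler_distD x _ _))// distrC.
have entry_le (w : c00 K) j : `|w j| <= `|w|.
  by have := schreier_sum_le w (admissible1 j); rewrite big_seq_fset1.
pose coord x j : K := limn (fun n => v (x, n) j : K^o).
have coordP x j : (v (x, n) j : K^o) @[n --> \oo] --> (coord x j : K^o).
  apply: Kc => e e0; have e20 : 0 < e / 2 by rewrite divr_gt0.
  have [N _ HN] := near_expr2V_le _ _ e20.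
  exists N => m n Nm Nn; apply: le_trans (entry_le (v (x, m) - v (x, n)) j) _.
  rewrite (le_trans (iB x _ _))// [leRHS]splitr lerD//
    ?(le_trans (Hv (x, _)))//;
    exact: HN.
have approx x (w : c00 K) A : admissible A ->
    \sum_(j <- A) `|coord x j - w j| <= `|x - i w|.
  move=> aA; apply/ler_addgt0Pr => e e0.
  have e20 : 0 < e / 2 by rewrite divr_gt0.
  (* Half of [e] is shared among the entries in [A], for replacing [coord x] by [v (x, n)]; the
     successor keeps the divisor nonzero. The other half covers the distance from [x] to
     [i (v (x, n))]. *)
  pose d := e / 2 / (#|` A|.+1)%:R.
  have d0 : 0 < d by rewrite divr_gt0// ltr0n.
  suff [n [nA en]] : exists n, (forall j, j \in enum_fset A ->
      `|coord x j - v (x, n) j| <= d) /\ (2 ^+ n)^-1 <= e / 2.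
    apply: (@le_trans _ _ (\sum_(j <- A) (d + `|(v (x, n) - w) j|))).
      rewrite big_seq [leRHS]big_seq; apply: ler_sum => j jA.
      by rewrite (le_trans (ler_distD (v (x, n) j) _ _))// lerD// nA.
    rewrite big_split/= addrC [in leRHS](splitr e) addrA lerD//.
      apply: le_trans (schreier_sum_le (v (x, n) - w) aA) _.
      rewrite (le_trans (iB x _ _))// addrC lerD//.
      by rewrite (le_trans (Hv (x, n))).
    rewrite big_const_seq count_predT iter_addr_0 -[_ *+ _]mulr_natr mulrAC.
    rewrite ler_pdivrMr ?ltr0n//.
    by rewrite ler_pM2l// ler_nat.
  have : \forall n \near \oo, (forall j, j \in enum_fset A ->
      `|coord x j - v (x, n) j| <= d) /\ (2 ^+ n)^-1 <= e / 2.
    near=> n; split; near: n; last exact: near_expr2V_le.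
    apply: near_all_mem => j.
    by move/cvgrPdist_le: (coordP x j) => /(_ _ d0).
  by case=> N _ HN; exists N; apply: HN => /=.
have approx1 x (w : c00 K) j : `|coord x j - w j| <= `|x - i w|.
  by have := approx x w _ (admissible1 j); rewrite big_seq_fset1.
exists coord; split.
- move=> a x y j; apply/eqP; rewrite -subr_eq0 -normr_le0.
  apply/ler_addgt0Pr => e e0; rewrite add0r.
  have e40 : 0 < e / 4 by rewrite divr_gt0.
  have a0 : 0 < `|a| + 1 by rewrite ltr_wpDl.
  have [w1 Hw1] := completion_approx x _ (divr_gt0 e40 a0).
  have [w2 Hw2] := completion_approx y _ e40.
  have aw : `|a| * `|x - i w1| <= e / 4.
    apply: (@le_trans _ _ ((`|a| + 1) * `|x - i w1|)).
      by rewrite ler_wpM2r// lerDl.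
    by rewrite mulrC -ler_pdivlMr.
  have -> : coord (a *: x + y) j - (a * coord x j + coord y j) =
    (coord (a *: x + y) j - (a *: w1 + w2) j) -
      (a * (coord x j - w1 j) + (coord y j - w2 j)).
    have -> : (a *: w1 + w2) j = a * w1 j + w2 j by [].
    ring.
  apply: le_trans (ler_normB _ _) _.
  have -> : e = (e / 4 + e / 4) + (e / 4 + e / 4) by field.
  apply: lerD.
    apply: le_trans (approx1 _ _ _) _.
    rewrite linearP opprD addrACA -scalerBr (le_trans (ler_normD _ _))//.
    by rewrite normrZ lerD.
  rewrite (le_trans (ler_normD _ _))// normrM lerD//.
    by rewrite (le_trans _ aw)// ler_wpM2l.
  exact: le_trans (approx1 _ _ _) Hw2.
- move=> x A aA; have := approx x 0 A aA; rewrite [i 0]linear0 subr0.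
  by under eq_bigr => j _ do rewrite (_ : (0 : c00 K) j = 0)// subr0.
- move=> x C C0 xC; apply/ler_addgt0Pr => e e0.
  have e20 : 0 < e / 2 by rewrite divr_gt0.
  have [w Hw] := completion_approx x _ e20.
  rewrite -(subrK (i w) x) (le_trans (ler_normD _ _))// addrC.
  rewrite [in leRHS](splitr e) addrA lerD// iN.
  apply: supremum_le => [_ [A _ <-]||_ [A aA <-]]; first exact: sumr_ge0.
    by exists (\sum_(j <- fset0) `|w j|), fset0 => //= j; rewrite inE.
  apply: le_trans (_ : \sum_(j <- A) (`|coord x j| + `|coord x j - w j|) <= _).
    apply: ler_sum => j _.
    by rewrite -[X in `|X| <= _](subKr (coord x j)) (le_trans (ler_normB _ _)).
  by rewrite big_split/= lerD ?xC// (le_trans (approx _ _ _ aA)).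
- move=> x e e0; have [w Hw] := completion_approx x _ e0.
  have /asboolP /finite_fsetP[B HB] := c00_valP w.
  (* From this index on [w] vanishes, so [coord x] coincides there with its difference from [w]. *)
  exists (\max_(j <- B) j).+1 => A aA Ap.
  apply: le_trans Hw; apply: le_trans (approx x w A aA).
  rewrite big_seq [leRHS]big_seq; apply: ler_sum => j jA.
  suff -> : w j = 0 by rewrite subr0.
  apply/eqP; apply: contraTT (Ap _ jA) => wj; rewrite -leqNgt.
  apply: (@leq_bigmax_seq _ _ _ id) => //.
  have : [set` B] j by rewrite -HB.
  by [].
Unshelve. all: by end_near. Qed.

End Completion.

Lemma near_comp_geid (P : nat -> Prop) (v : nat -> nat) :
  (forall N, \forall n \near \oo, (N <= v n)%N) ->
  (\forall n \near \oo, P n) -> \forall n \near \oo, P (v n).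
Proof.
by move=> hv [N _ HN]; have := hv N; apply: filterS => n Nn; exact: HN.
Qed.

Lemma near_leq_id (v : nat -> nat) : (forall n, (n <= v n)%N) ->
  forall N, \forall n \near \oo, (N <= v n)%N.
Proof. by move=> hv N; exists N => // n /= Nn; rewrite (leq_trans Nn). Qed.

Lemma sorted_ltn_leq_nth (s : seq nat) k :
  sorted ltn s -> (k < size s)%N -> (k <= nth 0%N s k)%N.
Proof.
move=> ss; elim: k => // k IH ks.
apply: leq_ltn_trans (IH (ltnW ks)) _.
by rewrite (sorted_ltn_nth ltn_trans)// inE ltnW.
Qed.

(** * Sums of squares of functionals as 2-homogeneous polynomials *)

Section QuadraticForms.
Variables (K : scalarFieldType) (Kc : cauchy_complete K).
Variables (E : normedModType K) (f : nat -> dual E) (C : K).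
Hypothesis C0 : 0 <= C.
Hypothesis fC : forall x N, \sum_(k < N) `|f k x| ^+ 2 <= C * `|x| ^+ 2.

(** The polar form, the sum of [f k x * f k y], converges absolutely because a product of moduli is
    at most the sum of their squares. It is bilinear and bounded, which gives continuity. *)
Lemma exists_square_sum_polynomial :
  exists P : E -> K^o, [/\ homogeneous_polynomial 2 P, continuous P &
    forall x, (\sum_(k < N) f k x ^+ 2 : K^o) @[N --> \oo] --> P x].
Proof.
have sumC x y N : \sum_(k < N) `|f k x * f k y| <=
    C * (`|x| ^+ 2 + `|y| ^+ 2).
  rewrite mulrDr; apply: le_trans (lerD (fC x N) (fC y N)).
  rewrite -big_split/=; apply: ler_sum => k _; rewrite normrM.
  have := @real_leVge _ `|f k x| `|f k y| (normr_real _) (normr_real _).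
  case/orP => h; rewrite -[leLHS]addr0.
    by rewrite addrC lerD ?exprn_ge0// expr2 ler_wpM2r.
  by rewrite lerD ?exprn_ge0// expr2 ler_wpM2l.
pose B x y : K^o := limn (fun N => \sum_(k < N) f k x * f k y : K^o).
have BP x y : (\sum_(k < N) f k x * f k y : K^o) @[N --> \oo] --> B x y.
  exact: (@bounded_sum_cvg _ Kc (fun k => f k x * f k y) _ (sumC x y)).
have Bsym x y : B x y = B y x.
  by congr (limn _); apply/funext => N; apply: eq_bigr => k _; rewrite mulrC.
have Blin a x x' y : B (a *: x + x') y = a * B x y + B x' y.
  have fxy : (\sum_(k < N) f k (a *: x + x') * f k y : K^o) @[N --> \oo] -->
      (a *: B x y + B x' y : K^o).
    rewrite [X in X @ _ --> _](_ : _ =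
        fun N => a *: (\sum_(k < N) f k x * f k y : K^o) +
        (\sum_(k < N) f k x' * f k y : K^o)).
      exact: cvgD (cvgZ (cvg_cst _) (BP x y)) (BP x' y).
    apply/funext => N; rewrite scaler_sumr -big_split/=; apply: eq_bigr => k _.
    by rewrite linearP mulrDl -scalerAl.
  exact: (cvg_unique (@norm_hausdorff _ K^o) (BP _ _) fxy).
have B0 y : B 0 y = 0.
  by have := Blin (-1) 0 0 y; rewrite scaler0 addr0 mulN1r addNr.
have Bhom a x y : B (a *: x) y = a * B x y.
  by have := Blin a x 0 y; rewrite addr0 B0 addr0.
have Bbound1 x y : `|B x y| <= C * (`|x| ^+ 2 + `|y| ^+ 2).
  apply: norm_lim_le (BP x y) _; apply: nearW => N.
  exact: le_trans (ler_norm_sum _ _ _) (sumC x y N).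
(* Rescaling both arguments to norm one turns [Bbound1] into a bilinear bound. *)
have Bbound x y : `|B x y| <= C * 2 * (`|x| * `|y|).
  have [->|x0] := eqVneq x 0.
    by rewrite B0 !normr0 mul0r mulr0.
  have [->|y0] := eqVneq y 0.
    by rewrite Bsym B0 !normr0 !mulr0.
  have nx : `|x| != 0 by rewrite normr_eq0.
  have ny : `|y| != 0 by rewrite normr_eq0.
  have -> : B x y = `|x| * `|y| * B (`|x|^-1 *: x) (`|y|^-1 *: y).
    rewrite Bhom [in RHS]Bsym Bhom Bsym; field.
    by rewrite nx ny.
  rewrite normrM (ger0_norm (mulr_ge0 _ _))// mulrC ler_wpM2r ?mulr_ge0//.
  apply: le_trans (Bbound1 _ _) _.
  by rewrite !normrZ !normfV !normr_id !mulVf// !expr1n.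
exists (fun x => B x x); split.
- exists (fun v => B (v ord0) (v ord_max)) => // v i a x y.
  have [->|i1] : i = ord0 \/ i = ord_max.
    by case: i => [[|[|//]] ?]; [left|right]; apply: val_inj.
    by rewrite !dfwithin !dfwithout// Blin.
  by rewrite i1 !dfwithin !dfwithout// Bsym Blin ![B _ (v _)]Bsym.
- move=> x; apply/cvgrPdist_le => e e0.
  (* For [y] within 1 of [x], the norm of [x + y] is at most [2 * |x| + 1], so [B (x - y) (x + y)]
     is controlled by [D] times the distance. The last [+ 1] keeps [D] positive. *)
  pose D := C * 2 * (2 * `|x| + 1) + 1.
  have D0 : 0 < D by rewrite ltr_wpDl// !mulr_ge0// addr_ge0// mulr_ge0.
  have xy1 : \forall y \near x, `|x - y| <= 1.
    by move/cvgrPdist_le: (@cvg_id _ (nbhs x)) => /(_ 1 ltr01).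
  have xyd : \forall y \near x, `|x - y| <= e / D.
    by move/cvgrPdist_le: (@cvg_id _ (nbhs x)) => /(_ _ (divr_gt0 e0 D0)).
  near=> y.
  have -> : B x x - B y y = B (x - y) (x + y).
    have -> : x - y = -1 *: y + x by rewrite scaleN1r addrC.
    rewrite Blin (Bsym y (x + y)) (Bsym x (x + y)).
    have BD u v w : B (u + v) w = B u w + B v w.
      by have := Blin 1 u v w; rewrite scale1r mul1r.
    by rewrite !BD (Bsym y x); ring.
  apply: le_trans (Bbound _ _) _.
  have y1 : `|x - y| <= 1 by near: y.
  have yd : `|x - y| <= e / D by near: y.
  have xy : `|x + y| <= 2 * `|x| + 1.
    have -> : x + y = (x + x) - (x - y).
      by rewrite opprB addrACA addrN addr0 addrC.
    rewrite (le_trans (ler_normB _ _))// lerD//.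
    by rewrite (le_trans (ler_normD _ _))// mulr2n mulrDl mul1r.
  apply: (@le_trans _ _ (C * 2 * (e / D * (2 * `|x| + 1)))).
    by rewrite ler_wpM2l ?mulr_ge0// ler_pM.
  have -> : C * 2 * (e / D * (2 * `|x| + 1)) = e * ((D - 1) / D).
    by rewrite /D; ring.
  rewrite -[leRHS]mulr1 ler_wpM2l ?(ltW e0)// ler_pdivrMr// mul1r.
  by rewrite gerBl.
- by move=> x; have := BP x x; under eq_fun do under eq_bigr do rewrite -expr2.
Unshelve. all: by end_near. Qed.

End QuadraticForms.

(** * Norming functionals and boundedness of weakly null sequences *)

Section SchreierSpace.
Variables (K : scalarFieldType) (Kc : cauchy_complete K).
Variables (E : normedModType K) (coord : E -> nat -> K).
Hypothesis HC : schreier_coordinates coord.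

Lemma coord_le x j : `|coord x j| <= `|x|.
Proof.
by have := coord_sum_le HC x _ (admissible1 j); rewrite big_seq_fset1.
Qed.

Lemma near_coord_le x (e : K) : 0 < e -> \forall j \near \oo, `|coord x j| <= e.
Proof.
move=> e0; have [p Hp] := coord_tail HC x _ e0.
exists p => // j /= pj; have := Hp _ (admissible1 j).
by rewrite big_seq_fset1; apply => i; rewrite inE => /eqP ->.
Qed.

Lemma exists_coord_dual j : exists F : dual E, forall x, F x = coord x j.
Proof.
apply: (@exists_dual _ _ (fun x => coord x j) 1) => // [a x y|x].
  by rewrite (coord_linear HC).
by rewrite mul1r coord_le.
Qed.

(** Some admissible set carries half the norm, and phases turn its sum of moduli into a functional.
    The factor one half leaves room below the supremum, so no maximizing set has to be found. *)
Lemma exists_half_norming x : exists F : dual E,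
  (forall y, `|F y| <= `|y|) /\ `|x| / 2 <= `|F x|.
Proof.
have [A aA xA] : exists2 A, admissible A &
    `|x| / 2 <= \sum_(j <- A) `|coord x j|.
  apply/not_exists2P => H.
  have h : `|x| <= `|x| / 2.
    apply: (norm_le_coord HC); first by rewrite divr_ge0.
    move=> A aA; have [//|/negP] := H A.
    rewrite -real_ltNge ?ger0_real ?divr_ge0 ?sumr_ge0//; exact: ltW.
  have x0 : `|x| <= 0.
    rewrite -(ler_pM2r (_ : 0 < 2^-1)) ?invr_gt0// mul0r.
    by rewrite -(lerD2l (`|x| / 2)) addr0 -splitr.
  have [na|nb] := H fset0; first by apply: na => j; rewrite inE.
  apply: nb; rewrite (_ : `|x| = 0) ?mul0r ?sumr_ge0//.
  by apply/eqP; rewrite normr_eq0 -normr_le0.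
have /choice[t /all_and2[t1 tx]] j :
    exists z : K, `|z| <= 1 /\ z * coord x j = `|coord x j|.
  by have [z z1 zj] := exists_phase K (coord x j); exists z.
have tle y : `|\sum_(j <- A) t j * coord y j| <= `|y|.
  apply: le_trans (coord_sum_le HC y A aA).
  apply: le_trans (ler_norm_sum _ _ _) _; apply: ler_sum => j _.
  by rewrite normrM ler_piMl.
have [|||F FE] := @exists_dual _ E (fun y => \sum_(j <- A) t j * coord y j) 1.
- by [].
- move=> a y z; rewrite mulr_sumr -big_split/=; apply: eq_bigr => j _.
  by rewrite (coord_linear HC) mulrDr mulrCA.
- by move=> y; rewrite mul1r.
exists F; split => [y|]; first by rewrite FE.
rewrite FE; under eq_bigr do rewrite tx.
by rewrite ger0_norm ?sumr_ge0.
Qed.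

(** In an unbounded sequence pick terms of norm at least [4 ^+ k]. A gliding hump then sums norming
    functionals weighted by powers of one half into a functional that stays away from 0 along these
    terms. *)
Lemma weakly_null_bounded (x : nat -> E) : weakly_null x ->
  exists2 B : K, 0 <= B & forall n, `|x n| <= B.
Proof.
move=> wx; apply/not_exists2P => H.
have ub k : exists n, (k <= n)%N /\ 4 ^+ k <= `|x n|.
  (* Including the first [k] norms forces any term exceeding [B] to have index at least [k]. *)
  pose B : K := 4 ^+ k + \sum_(i < k) `|x i|.
  have B0 : 0 <= B by rewrite addr_ge0 ?exprn_ge0 ?sumr_ge0.
  have [//|/existsNP[n /negP]] := H B.
  rewrite -real_ltNge ?ger0_real// => Bn; exists n; split.
    rewrite leqNgt; apply/negP => nk; move: Bn.
    rewrite le_gtF// /B (bigD1 (Ordinal nk))//= addrCA lerDl.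
    by rewrite addr_ge0 ?exprn_ge0 ?sumr_ge0.
  by apply: le_trans (ltW Bn); rewrite lerDl sumr_ge0.
have [v /all_and2[vk v4]] := choice ub.
have [f /all_and2[f1 fx]] := choice (fun k => exists_half_norming (x (v k))).
pose b m i : K := (2 ^+ i)^-1 * f i (x (v m)).
have e2 n : 0 < (2 ^+ n)^-1 :> K by rewrite invr_gt0 exprn_gt0.
have [|||||u [hu _ Hu]] := @gliding_hump K b (1 / 2) (fun _ _ => True).
- by rewrite divr_gt0.
- move=> n; rewrite normrM gtr0_norm//.
  apply: le_trans (ler_wpM2l (ltW (e2 n)) (fx n)).
  rewrite mulrA ler_pM2r ?invr_gt0//.
  apply: le_trans (ler_wpM2l (ltW (e2 n)) (v4 n)).
  rewrite (_ : 4 = 2 * 2 :> K); last by ring.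
  by rewrite exprMn mulKf ?expf_neq0// exprn_ege1// ler1n.
- move=> i d d0.
  have /(near_comp_geid _ _ (near_leq_id _ vk)) :=
    cvg0_near _ _ (wx (f i)) _ d0.
  apply: filterS => m; rewrite /b normrM gtr0_norm//; apply: le_trans.
  by rewrite ler_piMl// invf_le1 ?exprn_gt0// exprn_ege1// ler1n.
- move=> n d d0.
  have d1 : 0 < d / (`|x (v n)| + 1) by rewrite divr_gt0// ltr_wpDl.
  have := near_expr2V_le K _ d1; apply: filterS => i.
  rewrite ler_pdivlMr ?ltr_wpDl// => h; rewrite normrM gtr0_norm//.
  apply: le_trans h; rewrite ler_wpM2l ?(ltW (e2 _))//.
  by rewrite (le_trans (f1 i _))// lerDl.
- by move=> s; exact: nearW.
have g k : exists F : dual E, forall y, F y = (2 ^+ u k)^-1 * f (u k) y.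
  apply: (@exists_dual _ E (fun y => (2 ^+ u k)^-1 * f (u k) y) 1) => //.
    by move=> a y z; rewrite linearP mulrDr mulrCA.
  move=> y; rewrite normrM gtr0_norm// ler_pM ?(ltW (e2 _))//.
  by rewrite invf_le1 ?exprn_gt0// exprn_ege1// ler1n.
have {g}[g gE] := choice g.
have [||F HF] := @exists_sum_dual K Kc E g 2 => //.
  move=> y N; apply: le_trans (ler_wpM2r (normr_ge0 y) (sum_expr2V_le2 K N)).
  rewrite mulr_suml; apply: ler_sum => i _; rewrite gE normrM gtr0_norm//.
  apply: ler_pM => //.
  rewrite lef_pV2 ?posrE ?exprn_gt0// ler_weXn2l ?ler1n//.
  exact: homo_ltn_ge_id.
have Fge m : 1 / 2 / 2 <= `|F (x (v (u m)))|.
  apply: norm_lim_ge (HF _) _; first by rewrite !divr_ge0.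
  exists m.+1 => // N /= mN; apply: le_trans (Hu m N mN) _.
  by under [X in _ <= `|X|]eq_bigr do rewrite gE.
have e0 : 0 < 1 / 2 / 2 / 2 :> K by rewrite !divr_gt0.
have := cvg0_near _ _ (wx F) _ e0.
have vu n : (n <= v (u n))%N by rewrite (leq_trans (homo_ltn_ge_id _ hu n)).
move=> /(near_comp_geid _ _ (near_leq_id _ vu))[N _ /(_ N (leqnn N))/= Fle].
have := le_trans (Fge N) Fle.
rewrite -subr_ge0 (_ : _ - _ = - (1 / 8)) ?oppr_ge0; last by field.
by rewrite lt_geF// divr_gt0.
Qed.


End SchreierSpace.

(** * Square sums of coordinates and uniform smallness along P-null sequences *)

Section NullSequences.
Variables (K : scalarFieldType) (Kc : cauchy_complete K).
Variables (E : normedModType K) (coord : E -> nat -> K).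
Hypothesis HC : schreier_coordinates coord.

Lemma exists_small_entry x (s : seq nat) : uniq s -> (0 < size s)%N ->
  exists2 j, j \in s & (size s)%:R * `|coord x j| <= 2 * `|x|.
Proof.
move=> us s0; apply/not_exists2P => H.
have big j : j \in s -> 2 * `|x| < (size s)%:R * `|coord x j|.
  move=> js; have [//|/negP] := H j.
  by rewrite -real_ltNge ?ger0_real ?mulr_ge0.
(* The upper half [t] of [s] is admissible. *)
pose n := size s; pose t := drop n./2 (sort leq s).
have st : size t = (n - n./2)%N by rewrite size_drop size_sort.
have ut : uniq t by rewrite drop_uniq// sort_uniq.
have ts j : j \in t -> j \in s by move/mem_drop; rewrite mem_sort.
have hn : (n./2 * 2 <= n <= n./2 * 2 + 1)%N.
  by have := odd_double_half n; rewrite -muln2; case: odd; lia.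
have tsize : (n <= size t * 2)%N by rewrite st; lia.
have tx : \sum_(j <- t) `|coord x j| <= `|x|.
  have pt : perm_eq [fset j in t]%fset t.
    by apply: uniq_perm; rewrite ?fset_uniq// => j; rewrite !inE.
  rewrite -(perm_big _ pt); apply: (coord_sum_le HC) => j.
  rewrite !inE => jt.
  have -> : #|` [fset j in t]%fset| = size t by exact: perm_size pt.
  have ss : sorted ltn (sort leq s).
    by rewrite ltn_sorted_uniq_leq sort_uniq us sort_sorted//; exact: leq_total.
  have /(nthP 0%N)[k kt <-] := jt.
  rewrite nth_drop st; rewrite st in kt.
  have := @sorted_ltn_leq_nth _ (n./2 + k) ss.
  (* The entry at position [k] of [t] is at least [n./2 + k]. As indices start at 0, admissibility
     asks for [size t] at most its successor, which also covers odd [n], where [size t] is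
     [n./2 + 1]. *)
  rewrite size_sort -/n => h; apply: (@leq_trans (n./2 + k).+1); first by lia.
  by rewrite ltnS h; lia.
have t0 : (0 < size t)%N by lia.
have : n%:R * \sum_(j <- t) `|coord x j| <= n%:R * `|x| by rewrite ler_wpM2l.
apply/negP; rewrite -real_ltNge ?ger0_real ?mulr_ge0 ?sumr_ge0//.
apply: (@le_lt_trans _ _ (\sum_(j <- t) 2 * `|x|)).
  rewrite big_const_seq count_predT iter_addr_0 -mulrnAl.
  rewrite -[2 *+ _]mulr_natr -natrM mulnC.
  by rewrite ler_wpM2r// ler_nat.
rewrite mulr_sumr; case Et : t t0 => [//|i r] _; rewrite !big_cons.
apply: ltr_leD; first by rewrite big// ts// Et mem_head.
rewrite big_seq [leRHS]big_seq; apply: ler_sum => j jr.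
by rewrite ltW// big// ts// Et inE jr orbT.
Qed.

Lemma sum_inv_sqr_le N : \sum_(k < N) (k.+1%:R ^+ 2)^-1 <= 2 :> K.
Proof.
case: N => [|N]; first by rewrite big_ord0.
(* The sharper bound telescopes and makes the induction close. *)
suff h : \sum_(k < N.+1) (k.+1%:R ^+ 2)^-1 <= 2 - N.+1%:R^-1 :> K.
  by apply: le_trans h _; rewrite gerBl.
elim: N => [|N IH].
  by rewrite big_ord1 expr1n invr1 mulr2n addrK.
rewrite big_ord_recr/=; apply: le_trans (lerD IH (lexx _)) _.
rewrite -addrA lerD2l -subr_ge0 -[N.+2%:R]natr1.
have nz : N.+1%:R != 0 :> K by rewrite pnatr_eq0.
have nz' : N.+1%:R + 1 != 0 :> K by rewrite natr1 pnatr_eq0.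
rewrite (_ : _ - _ = (N.+1%:R * (N.+1%:R + 1) ^+ 2)^-1).
  by rewrite invr_ge0 mulr_ge0// exprn_ge0// natr1.
by move: (N.+1%:R) nz nz' => z z0 z1; field; rewrite z0 z1.
Qed.

(** Small entries are removed one at a time: with [n] left, the square removed is at most
    [4 * |x| ^+ 2 / n ^+ 2]. The inverse squares add up to at most 2, whence 8. *)
Lemma sum_coord_sqr_le x (s : seq nat) : uniq s ->
  \sum_(j <- s) `|coord x j| ^+ 2 <= 8 * `|x| ^+ 2.
Proof.
move=> us.
suff h : \sum_(j <- s) `|coord x j| ^+ 2 <=
    (4 * `|x| ^+ 2) * \sum_(k < size s) (k.+1%:R ^+ 2)^-1.
  apply: le_trans h _; rewrite (_ : 8 = 4 * 2); last by ring.
  by rewrite [leRHS]mulrAC ler_wpM2l ?mulr_ge0 ?exprn_ge0// sum_inv_sqr_le.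
elim: {s}(size s) {-2}s (erefl (size s)) us => [|n IH] s sn us.
  by rewrite (size0nil sn) big_nil big_ord0 mulr0.
have [|j js xj] := @exists_small_entry x s us; first by rewrite sn.
rewrite (perm_big _ (perm_to_rem js)) big_cons/= sn big_ord_recr/= mulrDr addrC.
have sr : size (rem j s) = n by rewrite size_rem ?sn.
apply: lerD; first by have := IH _ sr (rem_uniq _ us); rewrite ?sr; exact.

rewrite ler_pdivlMr ?exprn_gt0// -exprMn mulrC.
rewrite (_ : 4 * `|x| ^+ 2 = (2 * `|x|) ^+ 2); last by ring.
by rewrite ler_pXn2r ?nnegrE ?mulr_ge0// -sn.
Qed.

Variable M : closedSubspace E.

(** Otherwise entries of modulus at least [e] persist. A gliding hump on their squares produces a
    sum of squared coordinates, a continuous polynomial, that does not tend to 0 along the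
    sequence. *)
Lemma P_null_coord_sup (x : nat -> subspaceType M) : P_null x ->
  forall e : K, 0 < e ->
    \forall n \near \oo, forall j, `|coord (val (x n)) j| <= e.
Proof.
move=> Px e e0; apply: contrapT => nsup.
have ub N : exists nj : nat * nat,
    (N <= nj.1)%N /\ e <= `|coord (val (x nj.1)) nj.2|.
  apply: contra_notP nsup => /forallNP H; exists N => // n /= Nn j.
  have := H (n, j); move/not_andP => -[//|/negP]/=.
  by rewrite -real_ltNge ?realE ?normr_ge0 ?(ltW e0)// => /ltW.
have [v /all_and2[v1 v2]] := choice ub.
have /choice[f fE] j : exists F : dual (subspaceType M),
    forall y, F y = coord (val y) j.
  apply: (@exists_dual K (subspaceType M) (fun y => coord (val y) j) 1 ler01)
    => [a y z|y].
    exact: (coord_linear HC a (val y) (val z)).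
  by rewrite mul1r; exact: (coord_le _ _ _ HC).
have near0 j d : 0 < d -> \forall n \near \oo, `|coord (val (x n)) j| <= d.
  move=> d0; have := cvg0_near _ _ (P_null_weakly_null _ _ _ Px (f j)) _ d0.
  by apply: filterS => n; rewrite fE.
have near0v j d : 0 < d ->
    \forall n \near \oo, `|coord (val (x (v n).1)) j| <= d.
  by move=> d0; exact: near_comp_geid _ _ (near_leq_id _ v1) (near0 j d d0).
(* Each fixed coordinate tends to 0 along the sequence, so the positions of the large entries escape
   to infinity. This makes the rows of [b] vanish. *)
have v2oo J : \forall n \near \oo, (J <= (v n).2)%N.
  have e20 : 0 < e / 2 by rewrite divr_gt0.
  have := near_all_mem _ (iota 0 J) _ (fun j => near0v j _ e20).
  apply: filterS => n Hn; rewrite leqNgt; apply/negP => vJ.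
  have := le_trans (v2 n) (Hn (v n).2 _); rewrite mem_iota vJ => /(_ isT).
  by rewrite lt_geF// [ltRHS]splitr ltrDl.
have sqle (z d : K) : `|z| <= d -> `|z| <= 1 -> `|z ^+ 2| <= d.
  by move=> zd z1; rewrite normrX expr2 (le_trans _ zd)// ler_piMl.
pose b m i : K := coord (val (x (v m).1)) (v i).2 ^+ 2.
have [|||||u [hu Hv Hu]] := @gliding_hump K b (e ^+ 2)
    (fun s n => forall i, i \in s -> ((v i).2 < (v n).2)%N).
- by rewrite exprn_gt0.
- by move=> n; rewrite normrX ler_pXn2r ?nnegrE// ltW.
- move=> i d d0; near=> m; apply: sqle; near: m; exact: near0v.
- move=> n d d0.
  have near1 d' : 0 < d' ->
      \forall i \near \oo, `|coord (val (x (v n).1)) (v i).2| <= d'.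
    move=> d'0.
    exact: (near_comp_geid _ (fun i => (v i).2) v2oo
      (near_coord_le _ _ _ HC (val (x (v n).1)) _ d'0)).
  by near=> i; apply: sqle; near: i; exact: near1.
- by move=> s; apply: near_all_mem => i; exact: v2oo.
(* The positions are therefore distinct, as the square sum bound requires. *)
have ju : {homo (fun k => (v (u k)).2) : m n / (m < n)%N}.
  by move=> m n mn; apply: Hv; apply/mapP; exists m; rewrite ?mem_iota.
have [||P [Phom Pcont PE]] :=
  @exists_square_sum_polynomial K Kc _ (fun k => f (v (u k)).2) 8 => //.
  move=> y N.
  have uj : uniq [seq (v (u k)).2 | k <- iota 0 N].
    rewrite map_inj_uniq ?iota_uniq// => m n /eqP; apply: contraTeq.
    by rewrite neq_ltn => /orP[] /ju; rewrite ltn_neqAle => /andP[];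
      rewrite 1?eq_sym.
  have := sum_coord_sqr_le (val y) _ uj.
  rewrite big_map (_ : iota 0 N = index_iota 0 N) ?big_mkord; last first.
    by rewrite /index_iota subn0.
  by under [X in _ -> X <= _]eq_bigr do rewrite fE.
have Pge m : e ^+ 2 / 2 <= `|P (x (v (u m)).1)|.
  apply: norm_lim_ge (PE _) _; first by rewrite divr_ge0 ?exprn_ge0 ?ltW.
  exists m.+1 => // N /= mN; apply: le_trans (Hu m N mN) _.
  by under [X in _ <= `|X|]eq_bigr do rewrite fE.
have e20 : 0 < e ^+ 2 / 2 / 2 by rewrite !divr_gt0 ?exprn_gt0.
have vu n : (n <= (v (u n)).1)%N by rewrite (leq_trans (homo_ltn_ge_id _ hu n)).
have := cvg0_near _ _ (Px 2%N P isT Phom Pcont) _ e20.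
move=> /(near_comp_geid _ _ (near_leq_id _ vu))[N _ /(_ N (leqnn N))/= Ple].
have := le_trans (Pge N) Ple; apply/negP.
by rewrite lt_geF// [ltRHS]splitr ltrDl.
Unshelve. all: by end_near. Qed.

End NullSequences.

(** * Subsequences with bounded sums, as for the basis of [c_0] *)

Lemma sum_le_one_large (K : scalarFieldType) (c : nat -> K) (B : K) N :
  (forall i, 0 <= c i <= B) ->
  (forall i k, (i < k)%N -> c i <= (2 ^+ i)^-1 \/ c k <= (2 ^+ k)^-1) ->
  \sum_(i < N) c i <= B + 2.
Proof.
move=> cB c2; have B0 : 0 <= B by have /andP[] := cB 0%N; exact: le_trans.
have e2 n : 0 <= (2 ^+ n)^-1 :> K by rewrite invr_ge0 exprn_ge0.
apply: le_trans (lerD (lexx B) (sum_expr2V_le2 K N)).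
(* At most one term exceeds its power of one half; it costs [B], and the others form part of a
   geometric sum. *)
have [|] := pselect (exists k : 'I_N, ~ c k <= (2 ^+ k)^-1).
  move=> [k ck]; rewrite (bigD1 k)//= lerD//; first by have /andP[] := cB k.
  rewrite [leRHS](bigD1 k)//= -[leLHS]add0r lerD//; apply: ler_sum => i.
  by rewrite neq_ltn => /orP[] /c2[].
move=> /forallNP H; rewrite -[leLHS]add0r lerD//; apply: ler_sum => i _.
exact: contrapT (H i).
Qed.

Section Selection.
Variables (K : scalarFieldType) (E : normedModType K) (coord : E -> nat -> K).
Hypothesis HC : schreier_coordinates coord.

(** The selection rule is given as an eventual condition [Q] on the next index, so that a gliding
    hump can impose it on the same subsequence. *)
Lemma c0_selection (y : nat -> E) (B : K) :
  (forall n, `|y n| <= B) ->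
  (forall e : K, 0 < e ->
    \forall n \near \oo, forall j, `|coord (y n) j| <= e) ->
  exists Q : seq nat -> nat -> Prop, (forall s, \forall n \near \oo, Q s n) /\
    forall u, {homo u : m n / (m < n)%N} -> (forall k, Q (mkseq u k) (u k)) ->
    forall N (t : nat -> K), (forall k, `|t k| <= 1) ->
      `|\sum_(i < N) t i *: y (u i)| <= B + 2.
Proof.
move=> yB ysup.
have e2 n : 0 < (2 ^+ n)^-1 :> K by rewrite invr_gt0 exprn_gt0.
have B0 : 0 <= B by apply: le_trans (yB 0%N).
(* The part of [y n] beyond [p n] is negligible. An admissible [A] on which
   [y (u i)] is not small meets [[0, p (u i))], so [#|A| <= p (u i)], which
   makes the later [y (u k)] small on [A]. *)
have [p Hp] := choice (fun n => coord_tail HC (y n) _ (e2 n)).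
exists (fun s n => forall i, i \in s -> forall j,
  (p i)%:R * `|coord (y n) j| <= (2 ^+ size s)^-1); split.
  move=> s; apply: near_all_mem => i.
  have d0 : 0 < (2 ^+ size s)^-1 / (p i).+1%:R :> K by rewrite divr_gt0.
  apply: filterS (ysup _ d0) => n Hn j; have := Hn j.
  rewrite ler_pdivlMr ?ltr0n// mulrC; apply: le_trans.
  by rewrite ler_wpM2r// ler_nat.
move=> u hu Qu N t t1; apply: (norm_le_coord HC); first by rewrite addr_ge0.
move=> A aA; pose c i := \sum_(j <- A) `|coord (y (u i)) j|.
apply: (@le_trans _ _ (\sum_(i < N) c i)).
  rewrite exchange_big/=; apply: ler_sum => j _.
  have -> : coord (\sum_(i < N) t i *: y (u i)) j =
      \sum_(i < N) t i * coord (y (u i)) j.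
    have [F FE] := exists_coord_dual _ _ _ HC j.
    rewrite -FE linear_sum; apply: eq_bigr => i _; rewrite linearZ/=.
    by rewrite FE.
  apply: le_trans (ler_norm_sum _ _ _) _; apply: ler_sum => i _.
  by rewrite normrM ler_piMl.
(* On the fixed set [A], at most one [y (u i)] has substantial mass. *)
apply: sum_le_one_large => [i|i k ik].
  by rewrite sumr_ge0//= (le_trans (coord_sum_le HC _ _ aA)).
have [pA|] := pselect (forall j, j \in A -> (p (u i) <= j)%N).
  left; apply: le_trans (Hp (u i) A aA pA) _.
  rewrite lef_pV2 ?posrE ?exprn_gt0// ler_weXn2l ?ler1n//.
  exact: homo_ltn_ge_id.
move=> /existsNP[a /not_implyP[aA' /negP]]; rewrite -ltnNge => ap; right.
have p0 : 0 < (p (u i))%:R :> K by rewrite ltr0n (leq_ltn_trans _ ap).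
have yk j : `|coord (y (u k)) j| <= (2 ^+ k)^-1 / (p (u i))%:R.
  rewrite ler_pdivlMr// mulrC; have := Qu k (u i) _ j; rewrite size_mkseq.
  by apply; apply/mapP; exists i; rewrite ?mem_iota.
apply: (@le_trans _ _ (\sum_(j <- A) (2 ^+ k)^-1 / (p (u i))%:R)).
  by apply: ler_sum => j _.
rewrite big_const_seq count_predT iter_addr_0 -[_ *+ _]mulr_natr mulrAC.
rewrite ler_pdivrMr// ler_pM2l// ler_nat.
exact: leq_trans (aA a aA') ap.
Qed.

End Selection.

(** * The polynomial Dunford-Pettis property of closed subspaces *)

Lemma polynomial_Dunford_Pettis_subspace (K : scalarFieldType)
    (Kc : cauchy_complete K) (S : completeNormedModType K)
    (coord : S -> nat -> K) (HC : schreier_coordinates coord)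
    (M : closedSubspace S) : polynomial_Dunford_Pettis (subspaceType M).
Proof.
move=> x phi Px wphi; apply: contrapT => /not_cvg0_subsequence[e e0 [v vk ve]].
have wx := P_null_weakly_null _ _ _ Px.
have [B B0 xB] :=
  weakly_null_bounded _ Kc _ _ HC _ (weakly_null_val _ _ _ _ wx).
have xsup (d : K) : 0 < d -> \forall n \near \oo, forall j,
    `|coord (val (x (v n))) j| <= d.
  move=> d0.
  exact: near_comp_geid _ _ (near_leq_id _ vk)
    (P_null_coord_sup _ Kc _ _ HC _ _ Px d d0).
have [Q [HQ Qu]] := c0_selection _ _ _ HC _ _ (fun n => xB (v n)) xsup.
have ev n : exists F : dual (dual (subspaceType M)),
    forall psi : dual (subspaceType M), F psi = psi (x n).
  exact: exists_dual_eval.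
have [g gE] := choice ev.
(* Columns vanish because evaluations at points belong to the bidual and [phi] is weakly null; rows
   vanish because [x] is weakly null. *)
pose b m i : K := phi (v m) (x (v i)).
have [|||||u [hu Hv Hu]] := @gliding_hump K b e Q.
- by [].
- exact: ve.
- move=> i d d0.
  have := near_comp_geid _ _ (near_leq_id _ vk)
    (cvg0_near _ _ (wphi (g (v i))) _ d0).
  by apply: filterS => n; rewrite gE.
- move=> n d d0.
  exact: near_comp_geid _ _ (near_leq_id _ vk)
    (cvg0_near _ _ (wx (phi (v n))) _ d0).
- exact: HQ.
have [||F HF] :=
    @exists_sum_dual K Kc (dual (subspaceType M)) (fun i => g (v (u i))) (B + 2).
- by rewrite addr_ge0.
- move=> psi N.
  (* Phases turn the sum of moduli into [psi] of one combination of the [x (v (u i))], whose norm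
     [c0_selection] bounds by [B + 2]. *)
  have /choice[t /all_and2[t1 tx]] i :
      exists z : K, `|z| <= 1 /\ z * psi (x (v (u i))) = `|psi (x (v (u i)))|.
    by have [z z1 zj] := exists_phase K (psi (x (v (u i)))); exists z.
  have -> : \sum_(i < N) `|g (v (u i)) psi| =
      `|psi (\sum_(i < N) t i *: x (v (u i)))|.
    rewrite linear_sum [RHS]ger0_norm.
      by apply: eq_bigr => i _; rewrite linearZ gE -tx.
    by apply: sumr_ge0 => i _; rewrite linearZ [X in 0 <= X]tx.
  rewrite mulrC; apply: le_trans (le_opnorm _ _) _; apply: ler_wpM2l.
    exact: (normr_ge0 psi).
  have := Qu u hu Hv N t t1.
  rewrite (_ : \sum_(i < N) _ = val (\sum_(i < N) t i *: x (v (u i)))) //.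
  by rewrite raddf_sum; apply: eq_bigr.
(* The hump estimate survives the limit in [N], contradicting weak nullness of [phi] tested against
   [F]. *)
have Fge m : e / 2 <= `|F (phi (v (u m)))|.
  apply: norm_lim_ge (HF _) _; first by rewrite divr_ge0// ltW.
  exists m.+1 => // N /= mN; apply: le_trans (Hu m N mN) _.
  by under [X in _ <= `|X|]eq_bigr do rewrite gE.
have e20 : 0 < e / 2 / 2 by rewrite !divr_gt0.
have vu n : (n <= v (u n))%N by rewrite (leq_trans (homo_ltn_ge_id _ hu n)).
have := cvg0_near _ _ (wphi F) _ e20.
move=> /(near_comp_geid _ _ (near_leq_id _ vu))[N _ /(_ N (leqnn N))/= Fle].
have := le_trans (Fge N) Fle; apply/negP.
by rewrite lt_geF// [ltRHS]splitr ltrDl.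
Qed.

Theorem theorem15 (R : realType) :
  (forall (S : completeNormedModType R) (i : {linear c00 R -> S}),
     is_completion i -> hereditary_polynomial_Dunford_Pettis S) /\
  (forall (S : completeNormedModType R[i]) (i : {linear c00 R[i] -> S}),
     is_completion i -> hereditary_polynomial_Dunford_Pettis S).
Proof.
split=> S i Si M.
  have Kc := real_cauchy_complete R.
  have [coord HC] := exists_schreier_coordinates _ Kc _ _ Si.
  exact: polynomial_Dunford_Pettis_subspace Kc _ _ HC M.
have Kc := complex_cauchy_complete R.
have [coord HC] := exists_schreier_coordinates _ Kc _ _ Si.
exact: polynomial_Dunford_Pettis_subspace Kc _ _ HC M.
Qed.
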